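(* Let $T\ge 1$ be an integer, let $N=1+2T$, and let $$S^{(T)}(z)=z+a^{(0)}z^{1+T}+b^{(0)}z^{1+2T},\qquad a^{(0)}=2\,\frac{1+T}{1+2T}\,\sin\frac{\pi}{2+2T},\qquad b^{(0)}=\frac{1}{1+2T}.$$ Let $\mathcal{S}_N^T$ be the class of polynomials $P(z)=z+az^{1+T}+bz^{1+2T}$ of degree $N$, with $a,b\in\mathbb{R}$, that are univalent in the open unit disk $\mathbb{D}$. Then: (a) $S^{(T)}$ is univalent in $\mathbb{D}$; (b) $S^{(T)}$ is quasi-extremal in the sense of Ruscheweyh, i.e. the zeros of the derivative of $S^{(T)}$ lie on the unit circle $\{|z|=1\}$; (c) $S^{(T)}$ is extremal in the sense that it maximizes the absolute value of each coefficient among all polynomials in $\mathcal{S}_N^T$ with leading coefficient $1/N$; (d) $\displaystyle \max_{P\in\mathcal{S}_N^T}\left\{\max_{z\in\overline{\mathbb{D}}}|P(z)|\right\} = S^{(T)}(1)$; (e) $\displaystyle \min_{P\in\mathcal{S}_N^T}\left\{\frac{1}{P(1)}\left|P\left(e^{i\pi/T}\right)\right|\right\}=\frac{1}{S^{(T)}(1)}\left|S^{(T)}\left(e^{i\pi/T}\right)\right|$. Moreover, the extremal polynomial in problem (e) is unique, namely $S^{(T)}(z)$; in problems (c) and (d) the extremal polynomials are $S^{(T)}(z)$ and $-S^{(T)}(-z)$.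
   Context: $\mathbb{D}=\{z\in\mathbb{C}:|z|<1\}$ and $\overline{\mathbb{D}}=\{z\in\mathbb{C}:|z|\le 1\}$. A function is univalent in $\mathbb{D}$ if it is analytic and injective on $\mathbb{D}$. In general, $\mathcal{S}_N^T$ denotes the class of $T$-symmetric polynomials (only powers $z^{1+(j-1)T}$ occur) of degree $N=1+(n-1)T$ with real coefficients and first coefficient (the coefficient of $z$) equal to one that are univalent in $\mathbb{D}$; here $n=3$. The polynomial $S^{(T)}$ above is the case $n=3$ of $$S^{(T)}(z)=z+\sum_{j=2}^{n}\left(1-\frac{(j-1)T}{1+(n-1)T}\right)\prod_{k=1}^{j-1}\frac{\sin\frac{\pi(2+T(k-1))}{2+T(n-1)}}{\sin\frac{\pi Tk}{2+T(n-1)}}\,z^{T(j-1)+1}.$$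
   Formalization: For even T, −S(−z) = S(z) and the list of extremal polynomials in (c), (d) is incomplete; the exclusive list S(z), −S(−z) is stated for odd T only, and for all T the extremal polynomials are S(z) and e^{−iπ/T}S(e^{iπ/T}z). *)

(* Defs.v *)
From HB Require Import structures.
From mathcomp Require Import all_boot all_order all_algebra.
From mathcomp Require Import all_classical all_reals all_analysis.
From mathcomp Require Export complex.
Set Implicit Arguments.
Unset Strict Implicit.
Unset Printing Implicit Defensive.
Import Order.TTheory GRing.Theory Num.Theory.
Import numFieldNormedType.Exports.
Local Open Scope classical_set_scope.
Local Open Scope ring_scope.
Local Open Scope complex_scope.

Definition unit_disk (R : realType) : set R[i] := [set z | `|z| < 1].

Definition closed_unit_disk (R : realType) : set R[i] := [set z | `|z| <= 1].

(* The derivative is taken over the field R[i], so that the first clause is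
   complex differentiability on the open disk, i.e. analyticity. *)
Definition univalent (R : realType) (f : R[i] -> R[i]) : Prop :=
  (forall z, unit_disk z -> derivable (f : (R[i])^o -> (R[i])^o) z 1) /\
  set_inj (@unit_disk R) f.

(* The order of R[i] is x <= y <-> y - x is a nonnegative real; below, [is_max]
   and [is_min] are only applied to sets of real elements of R[i]. *)
Definition is_max (R : realType) (A : set R[i]) (m : R[i]) : Prop :=
  A m /\ ubound A m.

Definition is_min (R : realType) (A : set R[i]) (m : R[i]) : Prop :=
  A m /\ lbound A m.

Definition trinomial (R : realType) (T : nat) (a b : R) : {poly R[i]} :=
  'X + a%:C *: 'X^(1 + T) + b%:C *: 'X^(1 + 2 * T).

Definition S_class (R : realType) (T : nat) : set {poly R[i]} :=
  [set P | [/\ exists a b : R, P = trinomial T a b,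
               size P = (1 + 2 * T).+1 &
               univalent (horner P)]].

Definition a0 (R : realType) (T : nat) : R :=
  2 * ((1 + T)%:R / (1 + 2 * T)%:R) * sin (pi / (2 + 2 * T)%:R).

Definition b0 (R : realType) (T : nat) : R := 1 / (1 + 2 * T)%:R.

Definition S_poly (R : realType) (T : nat) : {poly R[i]} :=
  trinomial T (a0 R T) (b0 R T).

Definition quasi_extremal (R : realType) (P : {poly R[i]}) : Prop :=
  forall z : R[i], root P^`() z -> `|z| = 1.

(* exp (i * t) *)
Definition expi (R : realType) (t : R) : R[i] := cos t +i* sin t.

(* - P (- z) *)
Definition neg_reflection (R : realType) (P : {poly R[i]}) : {poly R[i]} :=
  - (P \Po (- 'X)).

(* exp (- i t) * P (exp (i t) * z) *)
Definition rotation (R : realType) (t : R) (P : {poly R[i]}) : {poly R[i]} :=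
  expi (- t) *: (P \Po (expi t *: 'X)).

Definition S_class_lead (R : realType) (T : nat) : set {poly R[i]} :=
  [set P | S_class T P /\ lead_coef P = (1 + 2 * T)%:R^-1].

Definition coef_extremal (R : realType) (T : nat) (P : {poly R[i]}) : Prop :=
  S_class_lead T P /\
  forall Q : {poly R[i]}, S_class_lead T Q -> forall j : nat, `|Q`_j| <= `|P`_j|.

Definition max_modulus (R : realType) (P : {poly R[i]}) (M : R[i]) : Prop :=
  is_max [set `|P.[z]| | z in @closed_unit_disk R] M.

Definition max_moduli (R : realType) (T : nat) : set R[i] :=
  [set M | exists2 P, S_class T P & max_modulus P M].

Definition modulus_extremal (R : realType) (T : nat) (P : {poly R[i]}) : Prop :=
  S_class T P /\ exists2 M, max_modulus P M & is_max (@max_moduli R T) M.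

(* P.[1] is a positive real for every P in the class. *)
Definition distortion (R : realType) (T : nat) (P : {poly R[i]}) : R[i] :=
  1 / P.[1] * `|P.[expi (pi / T%:R)]|.

Definition distortions (R : realType) (T : nat) : set R[i] :=
  [set distortion T P | P in @S_class R T].

Definition distortion_extremal (R : realType) (T : nat) (P : {poly R[i]}) :
    Prop :=
  S_class T P /\ is_min (@distortions R T) (distortion T P).

(* Main.v *)
Require Import Defs.
From HB Require Import structures.
From mathcomp Require Import all_boot all_order all_algebra.
From mathcomp Require Import all_classical all_reals all_analysis.
From mathcomp Require Import ring lra zify.
Import Order.TTheory GRing.Theory Num.Theory.
Import numFieldNormedType.Exports.
Import ComplexField.Normc.
Local Open Scope classical_set_scope.
Local Open Scope ring_scope.
Local Open Scope complex_scope.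

(** Write M = 1 + T and N = 1 + 2T.  For P = z + a z^M + b z^N and s in ]0, pi[,
      P (u e^(is)) - P (u e^(-is)) = 2 i u q_s (u^T),
    where q_s (Z) = sin s + a sin (M s) Z + b sin (N s) Z^2, and any two distinct
    points of equal modulus have the form u e^(is), u e^(-is)
    ([conjugate_form]).  Hence P is injective on every circle inside the disk as
    soon as no q_s has a zero in the disk, that is, for every s in ]0, pi[,
      |b sin (N s)| <= sin s  and  |a sin (M s)| <= sin s + b sin (N s).
    These are the [univalence_conditions].  They are necessary for univalence
    ([univalent_conditions]), and together with P' <> 0 they are sufficient, by
    Darboux's principle that injectivity on circles propagates to the disk
    ([Darboux_injective]).

    The whole extremal problem is decided at the single value s = pi / (2 M),
    called [apex] below.  There sin (M s) = 1 and sin (N s) = sin s, so the second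
    condition reads
      |a| <= (1 + b) sin (pi / (2 M))                      ([norm_a_le]).
    Equality turns the apex into an interior minimum of a nonnegative sine
    trinomial; its derivative there is cos (apex) (1 - N b), which forces b = 1 / N
    ([norm_a_eq]).  Letting s tend to 0 in the first condition gives |b| <= 1 / N
    ([norm_b_le]).  Since a0 = (1 + b0) sin (apex), these bounds yield (c) at
    b = 1 / N, give |P| <= 1 + |a| + |b| <= 1 + a0 + b0 on the disk for (d), and
    bound from below the quotient (1 + b - a) / (1 + b + a) that (e) minimizes,
    with the cases of equality.

    What remains is that S itself satisfies the conditions
    ([sin_trinomial_extremal_ge0]): the derivative of
    F = sin s + e a0 sin (M s) + sin (N s) / N, with e = 1 or -1, factors as
    cos (M s) (2 cos (T s) + e a0 M), and F is nonnegative at the zeros of either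
    factor.  Claim (b) follows from (a): in w = z^T the derivative of S is a
    palindromic quadratic, whose zeros come in pairs w, 1 / w, and none of them
    lies in the disk. *)

(** * Nonnegativity of the extremal sine trinomial *)

Section SineTrinomials.
Context {R : realType}.
Implicit Types (a b s t x y d : R) (T n : nat).

(** The one-sided version of the first-order condition is what serves at the
    endpoint 0, where the inequalities only hold on the right. *)
Lemma derive_ge0_right {f : R -> R} {x y d} : is_derive x 1 f d -> x < y ->
  (forall t, x < t < y -> f x <= f t) -> 0 <= d.
Proof.
move=> df xy fmin; have fd : derivable f x 1 by apply: ex_derive.
rewrite -(@derive_val _ _ _ _ _ _ _ df) ['D_1 f x]cvg_at_rightE//.
apply: limr_ge.
  rewrite -(cvg_at_rightE (fun h : R => h^-1 *: ((f \o shift x) _ - f x))) //.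
  apply: cvg_trans fd; apply: cvg_app.
  by move=> A [e egt0 Ae]; exists e => // x0 xe xgt0; apply: Ae => //; rewrite gt_eqF.
near=> h; apply: mulr_ge0.
  by rewrite invr_ge0; apply: ltW; near: h; exists 1 => /=.
rewrite subr_ge0 /= [_%:A]mulr1; apply: fmin.
rewrite ltrDr -ltrBrDr; apply/andP; split; near: h.
  by exists 1 => /=.
exists (y - x); first by rewrite /= subr_gt0.
by move=> h; rewrite /= distrC subr0 => /(le_lt_trans (ler_norm _)).
Unshelve. all: by end_near. Qed.

Definition sin_trinomial T a b s :=
  sin s + a * sin ((1 + T)%:R * s) + b * sin ((1 + 2 * T)%:R * s).

#[local] Instance is_derive_sin_trinomial T a b s :
  is_derive s 1 (sin_trinomial T a b)
    (cos s + a * ((1 + T)%:R * cos ((1 + T)%:R * s))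
           + b * ((1 + 2 * T)%:R * cos ((1 + 2 * T)%:R * s))).
Proof.
rewrite /sin_trinomial; apply: is_derive_eq.
by rewrite /GRing.scale /=; ring.
Qed.

Lemma norm_sin_mul_le n s : 0 <= s <= pi -> `|sin (n%:R * s)| <= n%:R * sin s.
Proof.
move=> s0pi; have sins := sin_ge0_pi s0pi.
elim: n => [|n ih]; first by rewrite !mul0r sin0 normr0.
rewrite -[n.+1]addn1 natrD !mulrDl !mul1r sinD.
rewrite (le_trans (ler_normD _ _))// !normrM.
rewrite lerD// ?(ger0_norm sins) ?ler_piMl ?cos_max//.
by rewrite (le_trans _ ih)// ler_piMr ?cos_max.
Qed.

Lemma sin_natpi n : sin (n%:R * pi) = 0 :> R.
Proof.
apply/eqP; rewrite -normr_le0 (le_trans (norm_sin_mul_le n pi _)) ?sinpi ?mulr0//.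
by rewrite pi_ge0 lexx.
Qed.

(** The angle at which the extremal trinomial satisfies the univalence
    conditions with equality. *)
Definition apex T : R := pi / (2 + 2 * T)%:R.

Lemma apex_gt0 T : 0 < apex T.
Proof. by rewrite divr_gt0 ?pi_gt0// ltr0n. Qed.

Lemma mul_apex T : (1 + T)%:R * apex T = pi / 2.
Proof.
rewrite /apex (_ : (2 + 2 * T)%N = (2 * (1 + T))%N); last lia.
by rewrite natrM; field; rewrite -[1]/(1%:R) -natrD pnatr_eq0.
Qed.

Lemma apex_le T : (1 <= T)%N -> apex T <= pi / 4.
Proof.
move=> T1; rewrite ler_pM2l ?pi_gt0// lef_pV2 ?posrE ?ltr0n//.
by rewrite ler_nat; lia.
Qed.

Lemma apex_lt_pi T : apex T < pi.
Proof.
by rewrite ltr_pdivrMr ?ltr0n// ltr_pMr ?pi_gt0// ltr1n.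
Qed.

Lemma sin_apex_gt0 T : 0 < sin (apex T).
Proof. by rewrite sin_gt0_pi// apex_gt0 apex_lt_pi. Qed.

(** The zeros of s |-> cos ((1 + T) s) in [0, pi] are symmetric about pi / 2, and
    the apex is the smallest of them. *)
Lemma sin_ge_apex T s : 0 <= s <= pi -> cos ((1 + T)%:R * s) = 0 ->
  sin (apex T) <= sin s.
Proof.
have pi0 := @pi_gt0 R; have apex0 := apex_gt0 T.
have apex_le_zero u : 0 <= u -> cos ((1 + T)%:R * u) = 0 -> apex T <= u.
  move=> u0 cosu; rewrite leNgt; apply/negP => ult.
  suff: 0 < cos ((1 + T)%:R * u) by rewrite cosu ltxx.
  apply: cos_gt0_pihalf; rewrite -(mul_apex T) ltr_pM2l ?ltr0n// ult andbT.
  by rewrite (@lt_le_trans _ _ 0) ?mulr_ge0// oppr_lt0 mulr_gt0 ?ltr0n.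
have sin_le u : 0 <= u <= pi / 2 -> cos ((1 + T)%:R * u) = 0 ->
    sin (apex T) <= sin u.
  move=> /andP[u0 u2] cosu; have := apex_le_zero _ u0 cosu.
  rewrite le_eqVlt => /predU1P[->//|lt]; apply: ltW.
  by rewrite ltr_sin// in_itv/=; apply/andP; split; lra.
move=> /andP[s0 spi] coss; case: (leP s (pi / 2)) => [s2|s2].
  by apply: sin_le => //; apply/andP.
have -> : sin s = sin (pi - s) by rewrite sinB sinpi cospi; ring.
apply: sin_le; first by apply/andP; split; lra.
by rewrite mulrBr cosB coss sin_natpi mul0r mulr0 addr0.
Qed.

(** With M = 1 + T and N = 1 + 2T, the derivative is
    cos (M s) (2 cos (T s) + e a0 M), so an interior minimum c is of one of two
    kinds.  If cos (M c) = 0, then sin (N c) = sin c and sin (M c) = 1 or -1, and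
    the value is at least (1 + b0) sin c - a0, which is nonnegative by
    [sin_ge_apex].  Otherwise 2 cos (T c) = - e a0 M, and M times the value is
    T (sin c - sin (N c) / N), nonnegative by [norm_sin_mul_le]. *)
Lemma sin_trinomial_extremal_ge0 T (e : R) s : e ^+ 2 = 1 -> 0 <= s <= pi ->
  0 <= sin_trinomial T (e * a0 R T) (b0 R T) s.
Proof.
move=> e1 s0pi; have pi0 := @pi_gt0 R.
pose f := sin_trinomial T (e * a0 R T) (b0 R T).
have df x : derivable f x 1 by apply: ex_derive.
have cf : {within `[0, pi], continuous f}.
  apply: continuous_subspaceT => x.
  by apply: differentiable_continuous; apply/derivable1_diffP.
(* It suffices to bound f at a minimum c; f vanishes at 0 and pi. *)
have [c cin fmin] := EVT_min (ltW pi0) cf.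
rewrite (le_trans _ (fmin s _)) ?in_itv//.
have f0 : f 0 = 0 by rewrite /f /sin_trinomial !mulr0 sin0; ring.
have fpi : f pi = 0 by rewrite /f /sin_trinomial !sin_natpi sinpi; ring.
have [->|cn0] := eqVneq c 0; first by rewrite f0.
have [->|cnpi] := eqVneq c pi; first by rewrite fpi.
have coo : c \in `]0, pi[%R.
  by move: cin; rewrite !in_itv /= !lt_neqAle cnpi eq_sym cn0.
have f'0 : is_derive c 1 f 0.
  apply: derive1_at_min (ltW pi0) _ coo _ => // t.
  by rewrite in_itv /= => /andP[t0 t1]; apply: fmin; rewrite in_itv /= !ltW.
move: cin; rewrite in_itv /= => c0pi.
have sinc0 := sin_ge0_pi c0pi.
have := @derive_val _ _ _ _ _ _ _ f'0.
rewrite (@derive_val _ _ _ _ _ _ _ (is_derive_sin_trinomial T _ _ c)).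
have M0 : 0 < (1 + T)%:R :> R by rewrite ltr0n.
have N0 : 0 < (1 + 2 * T)%:R :> R by rewrite ltr0n.
have NE : (1 + 2 * T)%:R = 2 * (1 + T)%:R - 1 :> R 
  by rewrite (natrD _ 1 (2 * T)) natrM (natrD _ 1 T); ring.
have := norm_sin_mul_le (1 + 2 * T) _ c0pi.
rewrite ler_norml => /andP[_].
rewrite /f /sin_trinomial /b0.
have NsE : (1 + 2 * T)%:R * c = ((1 + T)%:R * c + (1 + T)%:R * c) - c.
  by rewrite NE; ring.
rewrite NsE sinB cosB sinD cosD.
have := cos2Dsin2 ((1 + T)%:R * c); have := cos2Dsin2 c.
have := sin_ge_apex T _ c0pi.
move: NE N0 M0.
set M := (1 + T)%:R; set N := (1 + 2 * T)%:R => NE N0 M0.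
rewrite /a0 -/M -/N -/(apex T).
set A := sin (apex T); set x := cos c; set y := sin c.
set X := cos (M * c); set Y := sin (M * c).
move=> hA hxy hXY hN hf'.
have {hf'} : X * (2 * (X * x + Y * y) + e * (2 * (M / N) * A) * M) = 0.
  have NK z : 1 / N * (N * z) = z by field; rewrite gt_eqF.
  rewrite -hf' NK.
  have XY2 : X * X - Y * Y = 2 * X ^+ 2 - 1 by lra.
  by rewrite XY2; ring.
(* X, Y are cos and sin of M c, and X x + Y y is cos (T c). *)
move/eqP; rewrite mulf_eq0 => /orP[/eqP X0|/eqP h].
  have Y2 : Y ^+ 2 = 1 by rewrite -hXY X0; ring.
  have -> : y + e * (2 * (M / N) * A) * Y + 1 / N *
      ((Y * X + X * Y) * x - (X * X - Y * Y) * y) =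
      2 * (M / N) * (y + e * Y * A).
    rewrite X0.
    transitivity (y + e * (2 * (M / N) * A) * Y + 1 / N * Y ^+ 2 * y).
      by ring.
    by rewrite Y2 NE; field; lra.
  apply: mulr_ge0; first by rewrite mulr_ge0// divr_ge0// ltW.
  have : (e * Y) ^+ 2 = 1 by rewrite exprMn e1 Y2 mulr1.
  move/eqP; rewrite sqrf_eq1 => /orP[]/eqP->.
    by rewrite mul1r addr_ge0// ltW ?sin_apex_gt0.
  by rewrite mulN1r subr_ge0 hA.
rewrite -(pmulr_rge0 _ M0).
set w := (Y * X + X * Y) * x - (X * X - Y * Y) * y.
have wE : w = 2 * (X * x + Y * y) * Y - y.
  have := congr1 ( *%R y) hXY; rewrite mulr1 /w => yE; lra.
have -> : M * (y + e * (2 * (M / N) * A) * Y + 1 / N * w) =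
    (M - 1) * ((N * y - w) / N).
  have -> : M * (y + e * (2 * (M / N) * A) * Y + 1 / N * w) =
      M * y + (e * (2 * (M / N) * A) * M) * Y + M / N * w by ring.
  have -> : e * (2 * (M / N) * A) * M = - (2 * (X * x + Y * y)) by lra.
  have -> : M * y + - (2 * (X * x + Y * y)) * Y + M / N * w =
      (M - 1) * y - w + M / N * w by rewrite wE; ring.
  by rewrite NE; field; lra.
apply: mulr_ge0; first by rewrite /M natrD addrAC subrr add0r.
by apply: divr_ge0; [rewrite subr_ge0 | exact: ltW].
Qed.

End SineTrinomials.

(** * Collisions on a circle and zeros of real quadratics in the disk *)

Section ComplexPreliminaries.
Context {R : realType}.
Implicit Types (a b s t x y p q r : R) (T n : nat) (z w u : R[i]).

Lemma expi0 : expi 0 = 1 :> R[i].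
Proof. by rewrite /expi sin0 cos0. Qed.

Lemma expi_pi : expi pi = -1 :> R[i].
Proof. by rewrite /expi sinpi cospi; apply/eqP; rewrite eq_complex /= oppr0 !eqxx. Qed.

Lemma expiD s t : expi (s + t) = expi s * expi t :> R[i].
Proof.
rewrite /expi sinD cosD; apply/eqP; rewrite eq_complex /= eqxx /=.
by apply/eqP; ring.
Qed.

Lemma expiX t n : expi t ^+ n = expi (n%:R * t) :> R[i].
Proof.
elim: n => [|n ih]; first by rewrite mul0r expi0.
by rewrite exprS ih -expiD -[n.+1]add1n natrD mulrDl mul1r.
Qed.

Lemma norm_expi t : `|expi t| = 1 :> R[i].
Proof. by rewrite normc_def /= cos2Dsin2 sqrtr1. Qed.

Lemma expi_subN s : expi s - expi (- s) = 2 * 'i * (sin s)%:C :> R[i].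
Proof.
by rewrite /expi sinN cosN; apply/eqP; rewrite eq_complex /=; apply/andP; split;
  apply/eqP; ring.
Qed.

Lemma norm_lt1E x y : (`|x +i* y| < 1) = (x ^+ 2 + y ^+ 2 < 1).
Proof.
by rewrite normc_def ltcR /= -[X in (_ < X) = _]sqrtr1 ltr_sqrt ?ltr01.
Qed.

Lemma horner_trinomial T a b z :
  (trinomial T a b).[z] = z + a%:C * z ^+ (1 + T) + b%:C * z ^+ (1 + 2 * T).
Proof. by rewrite /trinomial !hornerE. Qed.

(** Two points of equal modulus collide exactly at a zero of a quadratic with
    real coefficients, evaluated at u ^+ T. *)
Lemma trinomial_sub_conj T a b u s :
  (trinomial T a b).[u * expi s] - (trinomial T a b).[u * expi (- s)] =
  2 * 'i * u * ((sin s)%:C + (a * sin ((1 + T)%:R * s))%:C * u ^+ T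
                 + (b * sin ((1 + 2 * T)%:R * s))%:C * (u ^+ T) ^+ 2).
Proof.
rewrite !horner_trinomial !exprMn !expiX.
transitivity (u * (expi s - expi (- s)) +
  a%:C * u ^+ (1 + T) * (expi ((1 + T)%:R * s) - expi (- ((1 + T)%:R * s))) +
  b%:C * u ^+ (1 + 2 * T) *
    (expi ((1 + 2 * T)%:R * s) - expi (- ((1 + 2 * T)%:R * s)))).
  by rewrite !mulrN; ring.
rewrite !expi_subN !rmorphM /= -exprM [(T * 2)%N]mulnC !exprD !expr1; ring.
Qed.

(** A nonreal zero z is excluded by p = r |z|^2 and |r| <= p.  For x real in
    ]-1, 1[ the value is at least (1 - |x|) (p - r |x|) > 0. *)
Lemma quadratic_disk_free p q r z : 0 < p -> `|r| <= p -> `|q| <= p + r ->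
  `|z| < 1 -> p%:C + q%:C * z + r%:C * z ^+ 2 != 0.
Proof.
case: z => x y p0; rewrite !ler_norml norm_lt1E => hr hq xy1.
apply/negP; rewrite eq_complex /= => /andP[/eqP hre /eqP him].
have {}hre : p + q * x + r * (x ^+ 2 - y ^+ 2) = 0 by lra.
have [y0|yn0] := eqVneq y 0; last first.
  have qE : q = - (2 * r * x) by apply: (mulIf yn0); lra.
  move: hre; rewrite qE => hre.
  have pE : p = r * (x ^+ 2 + y ^+ 2) by lra.
  have : 0 <= x ^+ 2 + y ^+ 2 by rewrite addr_ge0 ?sqr_ge0.
  move: pE xy1 hr; set m := x ^+ 2 + y ^+ 2; nra.
have pos t : 0 <= t < 1 -> 0 < (1 - t) * (p - r * t).
  move=> /andP[t0 t1]; apply: mulr_gt0; first by lra.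
  have -> : p - r * t = p * (1 - t) + (p - r) * t by ring.
  by rewrite ltr_pwDl ?mulr_gt0 ?mulr_ge0//; lra.
have x1 : -1 < x < 1.
  by rewrite -ltr_norml -sqrtr_sqr -sqrtr1 ltr_sqrt ?ltr01//; move: xy1; rewrite y0; lra.
move: hre; rewrite y0; case: (leP 0 x) => x0 hre.
  have := pos x; have : 0 <= (q + p + r) * x by rewrite mulr_ge0//; lra.
  lra.
have := pos (- x); have : 0 <= (p + r - q) * - x by rewrite mulr_ge0//; lra.
lra.
Qed.

(** The quadratic is positive at 0 and negative at -1. *)
Lemma quadratic_real_root p q r : 0 < p -> p + r < q ->
  exists2 z, `|z| < 1 & p%:C + q%:C * z + r%:C * z ^+ 2 = 0.
Proof.
move=> p0 qpr; pose f : {poly R} := r *: 'X^2 + q *: 'X + p%:P.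
have fE x : f.[x] = p + q * x + r * x ^+ 2 by rewrite /f !hornerE; ring.
have [|x x01 /rootP fx] := @poly_ivt R f (-1) 0 (lerN10 _).
  by rewrite !fE; apply/andP; split; lra.
move: x01 => /andP[x1 x0].
have xn1 : x != -1 by apply/eqP => xE; move: fx; rewrite xE fE; lra.
exists x%:C.
  rewrite -[x%:C]/(x +i* 0) norm_lt1E; have : -1 < x by rewrite lt_neqAle eq_sym xn1.
  nra.
by rewrite -rmorphXn -!rmorphM -!rmorphD /= -fE fx.
Qed.

(** The product p / r of the two zeros lies in the disk, hence so does one of
    them. *)
Lemma quadratic_prod_root p q r : 0 < p -> p < `|r| ->
  exists2 z, `|z| < 1 & p%:C + q%:C * z + r%:C * z ^+ 2 = 0.
Proof.
move=> p0 pr; have rn0 : r%:C != 0.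
  by apply/eqP => -[r0]; move: pr; rewrite r0 normr0; lra.
pose d := sqrtc (q%:C ^+ 2 - 4 * p%:C * r%:C).
have dE : d ^+ 2 = q%:C ^+ 2 - 4 * p%:C * r%:C by rewrite sqr_sqrtc.
pose z1 := (- q%:C + d) / (2 * r%:C); pose z2 := (- q%:C - d) / (2 * r%:C).
have z1E : p%:C + q%:C * z1 + r%:C * z1 ^+ 2 = 0.
  transitivity (p%:C - (q%:C ^+ 2 - d ^+ 2) / (4 * r%:C)).
    by rewrite /z1; field.
  by rewrite dE; field.
have z2E : p%:C + q%:C * z2 + r%:C * z2 ^+ 2 = 0.
  transitivity (p%:C - (q%:C ^+ 2 - d ^+ 2) / (4 * r%:C)).
    by rewrite /z2; field.
  by rewrite dE; field.
have z12 : z1 * z2 = p%:C / r%:C.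
  transitivity ((q%:C ^+ 2 - d ^+ 2) / (4 * r%:C ^+ 2)); first by rewrite /z1 /z2; field.
  by rewrite dE; field.
have [z1lt|z1ge] := boolP (`|z1| < 1); first by exists z1.
exists z2 => //; move: z1ge; rewrite -real_leNgt ?normr_real ?real1// => z1ge.
have : `|z1 * z2| < 1.
  rewrite z12 normrM normfV ltr_pdivrMr ?normr_gt0// mul1r.
  by rewrite !normc_def /= !expr0n !addr0 !sqrtr_sqr ltcR (gtr0_norm p0).
by apply: le_lt_trans; rewrite [`|z1 * z2|]normrM ler_peMl.
Qed.

Lemma quadratic_disk_free_coef p q r : 0 < p ->
  (forall z, `|z| < 1 -> p%:C + q%:C * z + r%:C * z ^+ 2 != 0) ->
  `|r| <= p /\ `|q| <= p + r.
Proof.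
move=> p0 nz; split; first rewrite leNgt; last rewrite ler_norml lerNl !leNgt.
  by apply/negP => /(quadratic_prod_root p q r p0)[z /nz/eqP].
apply/andP; split; apply/negP.
  move=> /(quadratic_real_root p (- q) r p0)[z z1 zE].
  have := nz (- z); rewrite normrN => /(_ z1)/eqP; apply.
  by rewrite -zE rmorphN /=; ring.
by move=> /(quadratic_real_root p q r p0)[z /nz/eqP].
Qed.

End ComplexPreliminaries.

(** * From injectivity on circles to injectivity on the disk *)

Section DividedDifference.
Context {K : comNzRingType}.
Implicit Types (P : {poly K}) (z w : K).

(** Unlike the quotient (P (z) - P (w)) / (z - w), this is continuous across the
    diagonal, where its value is P' (z): limits of collisions remain visible. *)
Definition divided_difference P z w :=
  \sum_(i < size P) P`_i * \sum_(j < i) z ^+ (i.-1 - j) * w ^+ j.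

Lemma divided_differenceE P z w :
  (z - w) * divided_difference P z w = P.[z] - P.[w].
Proof.
rewrite !horner_coef -sumrB mulr_sumr; apply: eq_bigr => i _.
by rewrite mulrCA -subrXX mulrBr.
Qed.

Lemma divided_difference_diag P z : divided_difference P z z = P^`().[z].
Proof.
rewrite /divided_difference /deriv horner_poly.
case: (size P) => [|n]; first by rewrite !big_ord0.
rewrite big_ord_recl big_ord0 mulr0 add0r; apply: eq_bigr => i _ /=.
rewrite /bump /= add1n mulrnAl -mulrnAr; congr (_ * _).
rewrite (eq_bigr (fun=> z ^+ i)) ?sumr_const ?card_ord// => j _.
by rewrite -exprD subnK// -ltnS.
Qed.

End DividedDifference.

Section ContinuousParts.
Context {R : realType} {X : topologicalType}.
Implicit Types (g h : X -> R[i]).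

(** Continuity into R[i] is expressed by two real-valued functions, so that
    compactness and the extreme value theorem are only used over R. *)
Definition continuous_parts g :=
  continuous (fun v => complex.Re (g v)) /\ continuous (fun v => complex.Im (g v)).

Lemma continuous_parts_cst (c : R[i]) : continuous_parts (fun=> c).
Proof. by split=> x; exact: cvg_cst. Qed.

Lemma continuous_partsD g h : continuous_parts g -> continuous_parts h ->
  continuous_parts (fun v => g v + h v).
Proof.
move=> [gr gi] [hr hi]; split=> x.
- rewrite (_ : (fun v => _) = (fun v => complex.Re (g v) + complex.Re (h v))).
    by apply: cvgD; [exact: gr|exact: hr].
  by apply/funext => v; case: (g v) (h v) => ? ? [].
- rewrite (_ : (fun v => _) = (fun v => complex.Im (g v) + complex.Im (h v))).
    by apply: cvgD; [exact: gi|exact: hi].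
  by apply/funext => v; case: (g v) (h v) => ? ? [].
Qed.

Lemma continuous_partsM g h : continuous_parts g -> continuous_parts h ->
  continuous_parts (fun v => g v * h v).
Proof.
move=> [gr gi] [hr hi]; split=> x.
- rewrite (_ : (fun v => _) = (fun v => complex.Re (g v) * complex.Re (h v) -
      complex.Im (g v) * complex.Im (h v))).
    by apply: cvgB; apply: cvgM; [exact: gr|exact: hr|exact: gi|exact: hi].
  by apply/funext => v; case: (g v) (h v) => ? ? [].
- rewrite (_ : (fun v => _) = (fun v => complex.Re (g v) * complex.Im (h v) +
      complex.Im (g v) * complex.Re (h v))).
    by apply: cvgD; apply: cvgM; [exact: gr|exact: hi|exact: gi|exact: hr].
  by apply/funext => v; case: (g v) (h v) => ? ? [].
Qed.

Lemma continuous_partsX g n : continuous_parts g ->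
  continuous_parts (fun v => g v ^+ n).
Proof.
move=> cg; elim: n => [|n ih]; first exact: continuous_parts_cst.
rewrite (_ : (fun v => _) = (fun v => g v * g v ^+ n)).
  exact: continuous_partsM.
by apply/funext => v; rewrite exprS.
Qed.

Lemma continuous_parts_sum (I : Type) (r : seq I) (F : I -> X -> R[i]) :
  (forall i, continuous_parts (F i)) ->
  continuous_parts (fun v => \sum_(i <- r) F i v).
Proof.
move=> cF; elim: r => [|i r ih].
  rewrite (_ : (fun v => _) = (fun=> 0)); first exact: continuous_parts_cst.
  by apply/funext => v; rewrite big_nil.
rewrite (_ : (fun v => _) = (fun v => F i v + \sum_(j <- r) F j v)).
  exact: continuous_partsD.
by apply/funext => v; rewrite big_cons.
Qed.

Lemma continuous_parts_horner (P : {poly R[i]}) g : continuous_parts g ->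
  continuous_parts (fun v => P.[g v]).
Proof.
move=> cg; rewrite (_ : (fun v => _) = (fun v => \sum_(i < size P) P`_i * g v ^+ i)).
  apply: continuous_parts_sum => i; apply: continuous_partsM.
    exact: continuous_parts_cst.
  exact: continuous_partsX.
by apply/funext => v; rewrite horner_coef.
Qed.

Lemma continuous_parts_divided_difference (P : {poly R[i]}) g h :
  continuous_parts g -> continuous_parts h ->
  continuous_parts (fun v => divided_difference P (g v) (h v)).
Proof.
move=> cg ch; apply: continuous_parts_sum => i.
apply: continuous_partsM; first exact: continuous_parts_cst.
apply: continuous_parts_sum => j.
by apply: continuous_partsM; apply: continuous_partsX.
Qed.

Definition sq_norm (z : R[i]) : R := complex.Re z ^+ 2 + complex.Im z ^+ 2.

Lemma continuous_sq_norm g : continuous_parts g -> continuous (fun v => sq_norm (g v)).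
Proof.
move=> [gr gi] x; apply: cvgD; apply: cvgM; [exact: gr|exact: gr|exact: gi..].
Qed.

End ContinuousParts.

Section Darboux.
Context {R : realType}.
Implicit Types (z w c : R[i]) (P : {poly R[i]}).

Lemma sq_normE z : sq_norm z = normc z ^+ 2.
Proof. by case: z => x y; rewrite /= sqr_sqrtr// addr_ge0 ?sqr_ge0. Qed.

Lemma normc_ge0 z : 0 <= normc z.
Proof. by case: z => x y; exact: sqrtr_ge0. Qed.

(** |P (w) - c| is |lead_coef P| times the product of the distances from w to the
    points where P takes the value c; if it is small, one of them is near w. *)
Lemma nearby_preimage P w c (e : R) : (1 < size P)%N -> 0 < e ->
  normc (P.[w] - c) < normc (lead_coef P) * e ^+ (size P).-1 ->
  exists2 w', P.[w'] = c & normc (w' - w) < e.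
Proof.
move=> sP e0 Pwc; pose Q := P - c%:P.
have szc : (size (- c%:P)%R < size P)%N.
  by rewrite size_polyN (leq_ltn_trans (size_polyC_leq1 c)).
have lQ : lead_coef Q = lead_coef P by rewrite lead_coefDl.
have sQ : size Q = size P by rewrite size_polyDl.
have [r Qr] := closed_field_poly_normal Q.
have lP0 : lead_coef P != 0 by rewrite lead_coef_eq0 -size_poly_gt0; lia.
have sr : size r = (size P).-1.
  by rewrite -sQ Qr size_scale ?lQ// size_prod_XsubC.
have [/hasP[w' w'r w'w]|/hasPn far] := boolP (has (fun x => normc (x - w) < e) r).
  exists w' => //; apply/eqP; rewrite -subr_eq0.
  have : root Q w' by rewrite Qr rootZ ?lQ// root_prod_XsubC.
  by rewrite /root /Q !hornerE.
suff : normc (lead_coef P) * e ^+ (size P).-1 <= normc (P.[w] - c).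
  by rewrite leNgt Pwc.
have -> : P.[w] - c = Q.[w] by rewrite /Q !hornerE.
rewrite Qr hornerZ normcM lQ ler_wpM2l ?normc_ge0// -sr horner_prod.
elim: r far {Qr sr} => [|x r ih] far; first by rewrite big_nil normc1.
rewrite big_cons normcM exprS !hornerE.
apply: ler_pM; [exact: ltW|by rewrite exprn_ge0// ltW|..].
  have := far x; rewrite mem_head -leNgt => /(_ isT).
  by rewrite -(normcN (x - w)) opprB.
by apply: ih => y yr; apply: far; rewrite in_cons yr orbT.
Qed.

(** Moving z radially inwards to t z, with t slightly below 1, changes P (z)
    little, so [nearby_preimage] provides w' near w with P (w') = P (t z).  As w is
    strictly inside the circle through z, so is w' inside the one through t z. *)
Lemma collision_shrinks P z w : (1 < size P)%N -> normc w < normc z -> P.[z] = P.[w] ->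
  exists z' w', [/\ normc w' < normc z', normc z' < normc z & P.[z'] = P.[w']].
Proof.
move=> sP wz Pzw; pose e := (normc z - normc w) / 2.
have e0 : 0 < e by rewrite divr_gt0// subr_gt0.
have z0 : 0 < normc z := le_lt_trans (normc_ge0 w) wz.
have lP0 : 0 < normc (lead_coef P).
  rewrite lt_neqAle normc_ge0 andbT eq_sym; apply/eqP => /eq0_normc/eqP.
  by rewrite lead_coef_eq0 => /eqP P0; move: sP; rewrite P0 size_poly0.
pose k := normc (lead_coef P) * e ^+ (size P).-1.
have k0 : 0 < k by rewrite mulr_gt0// exprn_gt0.
pose h (t : R) := sq_norm (P.[w] - P.[t%:C * z]).
have ch : continuous h.
  apply: continuous_sq_norm.
  rewrite (_ : (fun v : R => _) = (fun v : R => P.[w] + (-1) * P.[v%:C * z])); last first.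
    by apply/funext => v; rewrite mulN1r.
  apply: continuous_partsD; first exact: continuous_parts_cst.
  apply: continuous_partsM; first exact: continuous_parts_cst.
  apply: continuous_parts_horner; apply: continuous_partsM.
    by split=> x; [exact: cvg_id|exact: cvg_cst].
  exact: continuous_parts_cst.
have h1 : h 1 = 0 by rewrite /h mul1r Pzw subrr sq_normE normc0 expr0n.
have [t [t1 tz ht]] : exists t : R, [/\ t < 1, normc w + e < t * normc z & h t < k ^+ 2].
  near (1 : R)^'- => t; exists t; split; near: t.
  - exact: nbhs_left_lt.
  - near=> t; rewrite -ltr_pdivrMr//; near: t; apply: nbhs_left_gt.
    by rewrite ltr_pdivrMr// mul1r /e; lra.
  - apply: (@cvgr_lt _ _ _ _ h (h 1)); last by rewrite h1 exprn_gt0.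
    exact: cvg_at_left_filter (ch 1).
have t0 : 0 < t.
  have := normc_ge0 w; rewrite -(pmulr_lgt0 _ z0); lra.
have [|w' Pw' ww'] := nearby_preimage P w P.[t%:C * z] e sP e0.
  rewrite -/k -(@ltr_pXn2r _ 2) ?nnegrE ?normc_ge0 ?ltW//.
  by rewrite -sq_normE.
have normt : normc (t%:C * z) = t * normc z.
  by rewrite normcM /= expr0n addr0 sqrtr_sqr gtr0_norm.
exists (t%:C * z), w'; split; last by [].
  rewrite normt; apply: lt_trans tz.
  have : normc w' <= normc (w' - w) + normc w.
    by apply: le_trans (le_normcD _ _); rewrite subrK.
  by move=> /le_lt_trans; apply; rewrite addrC ltrD2l.
by rewrite normt gtr_pMl.
Unshelve. all: by end_near. Qed.

(** Darboux's principle.  Among the zeros (z, w) of the divided difference in a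
    compact bidisk, take one that minimizes max (|z|, |w|).  It is off the diagonal
    because P' does not vanish, hence a collision, and |z| <> |w| by injectivity on
    circles; then [collision_shrinks] contradicts minimality. *)
Lemma Darboux_injective P : (forall z, `|z| < 1 -> P^`().[z] != 0) ->
  (forall z w, `|z| < 1 -> `|z| = `|w| -> P.[z] = P.[w] -> z = w) ->
  forall z w, `|z| < 1 -> `|w| < 1 -> P.[z] = P.[w] -> z = w.
Proof.
move=> dP circ z w z1 w1 Pzw; apply/eqP; rewrite -[_ == _]negbK; apply/negP => zw.
have sP : (1 < size P)%N.
  rewrite ltnNge; apply/negP => /size1_polyC PE.
  have := dP 0; rewrite normr0 => /(_ ltr01).
  by rewrite PE derivC horner0 eqxx.
pose point (v : R * R) : R[i] := v.1 +i* v.2.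
pose box : set (R * R) := `[-1, 1] `*` `[-1, 1].
pose D (v : (R * R) * (R * R)) := divided_difference P (point v.1) (point v.2).
pose K : set ((R * R) * (R * R)) := (box `*` box) `&`
  ([set v | complex.Re (D v) = 0] `&` [set v | complex.Im (D v) = 0]).
have cpt1 : continuous_parts (fun v : (R * R) * (R * R) => point v.1).
  split=> v.
    exact: (continuous_comp cvg_fst cvg_fst).
  exact: (continuous_comp cvg_fst cvg_snd).
have cpt2 : continuous_parts (fun v : (R * R) * (R * R) => point v.2).
  split=> v.
    exact: (continuous_comp cvg_snd cvg_fst).
  exact: (continuous_comp cvg_snd cvg_snd).
have [cDr cDi] : continuous_parts D by exact: continuous_parts_divided_difference.
have cK : compact K.
  apply: compact_closedI.
    by apply: compact_setX; apply: compact_setX; exact: segment_compact.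
  apply: closedI.
    by apply: (@closed_comp _ _ (fun v => complex.Re (D v)) [set x | x = 0])
      => [v _|]; [exact: cDr|exact: closed_eq].
  by apply: (@closed_comp _ _ (fun v => complex.Im (D v)) [set x | x = 0])
    => [v _|]; [exact: cDi|exact: closed_eq].
pose m v := Num.max (sq_norm (point v.1)) (sq_norm (point v.2)).
have cm : continuous m.
  by move=> v; apply: (@continuous_max _ _ (fun v => sq_norm (point v.1))
    (fun v => sq_norm (point v.2)) v); exact: continuous_sq_norm.
have lt1 u : (`|u| < 1) = (sq_norm u < 1) by case: u => x y; rewrite norm_lt1E.
(* K contains every collision in the open disk, in real coordinates. *)
have K_point z' w' : `|z'| < 1 -> `|w'| < 1 -> z' != w' -> P.[z'] = P.[w'] ->
    K ((complex.Re z', complex.Im z'), (complex.Re w', complex.Im w')).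
  rewrite !lt1 => z'1 w'1 zw' Pzw'.
  have Pdd : divided_difference P z' w' = 0.
    apply/eqP; have := divided_differenceE P z' w'; rewrite Pzw' subrr => /eqP.
    by rewrite mulf_eq0 subr_eq0 (negPf zw').
  have in_box u : sq_norm u < 1 -> box (complex.Re u, complex.Im u).
    case: u => x y; rewrite /sq_norm /= => xy1.
    by split; rewrite /= in_itv /=; nra.
  split; first by split; exact: in_box.
  by case: z' w' Pdd {z'1 w'1 zw' Pzw'} => [? ?] [? ?] /= Pdd; split; rewrite /D /= Pdd.
have [[v1 v2]] : exists2 v, v \in K & forall t, t \in K -> m v <= m t.
  apply: compact_EVT_min => //; last exact: continuous_subspaceT.
  by eexists; exact: (K_point z w).
move=> /set_mem[_ [Dr Di]] mmin.
set z0 := point v1 in Dr Di *; set w0 := point v2 in Dr Di *.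
have m_le z' w' : `|z'| < 1 -> `|w'| < 1 -> z' != w' -> P.[z'] = P.[w'] ->
    Num.max (sq_norm z0) (sq_norm w0) <= Num.max (sq_norm z') (sq_norm w').
  move=> z'1 w'1 zw' Pzw'; have /mem_set/mmin := K_point _ _ z'1 w'1 zw' Pzw'.
  by case: z' w' {z'1 w'1 zw' Pzw'} => [? ?] [? ?].
have [z01 w01] : `|z0| < 1 /\ `|w0| < 1.
  rewrite !lt1; apply/andP; rewrite -gt_max.
  by apply: le_lt_trans (m_le z w z1 w1 zw Pzw) _; rewrite gt_max -!lt1 z1.
have D0 : divided_difference P z0 w0 = 0.
  by apply/eqP; rewrite eq_complex; apply/andP; split; apply/eqP.
have zw0 : z0 != w0.
  apply/eqP => zwE; have /eqP := dP z0 z01.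
  by rewrite -divided_difference_diag {2}zwE.
have Pzw0 : P.[z0] = P.[w0].
  by apply/eqP; rewrite -subr_eq0 -divided_differenceE D0 mulr0.
have lt_norm (u u' : R[i]) : (normc u < normc u') = (sq_norm u < sq_norm u').
  by rewrite !sq_normE ltr_pXn2r// nnegrE normc_ge0.
have no_descent z' w' : `|z'| < 1 -> normc w' < normc z' -> P.[z'] = P.[w'] ->
    Num.max (sq_norm z0) (sq_norm w0) <= sq_norm z'.
  move=> z'1 wz' Pzw'; have w'1 : `|w'| < 1.
    by apply: lt_trans z'1; rewrite ltcR.
  have zw' : z' != w' by apply: contra_ltN wz' => /eqP->.
  have := m_le z' w' z'1 w'1 zw' Pzw'.
  by rewrite [X in _ <= X]max_l// ltW// -lt_norm.
case: (ltgtP (normc w0) (normc z0)) => wz0.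
- have [z' [w' [wz' zz' Pzw']]] := collision_shrinks P z0 w0 sP wz0 Pzw0.
  have := no_descent z' w' _ wz' Pzw'; rewrite ge_max => /(_ _)/andP[|+ _].
    by apply: lt_trans z01; rewrite ltcR.
  by rewrite leNgt -lt_norm zz'.
- have [z' [w' [wz' zz' Pzw']]] := collision_shrinks P w0 z0 sP wz0 (esym Pzw0).
  have := no_descent z' w' _ wz' Pzw'; rewrite ge_max => /(_ _)/andP[|_].
    by apply: lt_trans w01; rewrite ltcR.
  by rewrite leNgt -lt_norm zz'.
- by move/eqP: zw0; apply; apply: circ => //; congr (_%:C).
Qed.

End Darboux.

(** * Bounds on the coefficients *)

Section CoefficientRegion.
Context {R : realType}.
Implicit Types (a b e s t : R) (T : nat).

Lemma natr_b0 T : (1 + 2 * T)%:R * b0 R T = 1.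
Proof. by rewrite /b0 mulrC divfK// pnatr_eq0. Qed.

Lemma b0_gt0 T : 0 < b0 R T.
Proof. by rewrite divr_gt0// ltr0n. Qed.

Lemma b0_lt1 T : (1 <= T)%N -> b0 R T < 1.
Proof. by move=> T1; rewrite ltr_pdivrMr ?ltr0n// mul1r ltr1n; lia. Qed.

Lemma a0E T : a0 R T = (1 + b0 R T) * sin (apex T).
Proof.
rewrite /a0 /b0 -/(apex T); congr (_ * _).
have : (1 + 2 * T)%:R != 0 :> R by rewrite pnatr_eq0.
rewrite (natrD _ 1 (2 * T)) natrM (natrD _ 1 T) => N0.
by field.
Qed.

Lemma a0_gt0 T : 0 < a0 R T.
Proof. by rewrite a0E mulr_gt0 ?sin_apex_gt0// addr_gt0// b0_gt0. Qed.

Lemma sin_apex_lt1 T : (1 <= T)%N -> sin (apex T) < 1 :> R.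
Proof.
move=> T1; have pi0 := @pi_gt0 R; have ap := @apex_gt0 R T; have apl := @apex_le R T T1.
rewrite -(@sin_pihalf R) ltr_sin ?in_itv/=; try (apply/andP; split); lra.
Qed.

(** The nonnegative extremal sine trinomial with e = -1 vanishes at 0, and its
    derivative there is 2 - (1 + T) a0. *)
Lemma a0_natr_le T : (1 + T)%:R * a0 R T <= 2.
Proof.
have := @derive_ge0_right R _ 0 pi _
  (is_derive_sin_trinomial T (-1 * a0 R T) (b0 R T) 0) (@pi_gt0 R).
rewrite !mulr0 cos0 !mulr1 [b0 R T * _]mulrC natr_b0 => H.
rewrite -subr_ge0 (_ : 2 - _ = 1 + -1 * a0 R T * (1 + T)%:R + 1); last by ring.
apply: H => t /andP[t0 tpi].
rewrite [leLHS](_ : _ = 0); last by rewrite /sin_trinomial !mulr0 sin0; ring.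
by rewrite sin_trinomial_extremal_ge0 ?sqrrN ?expr1n// !ltW.
Qed.

Lemma natr_apex T : (1 + 2 * T)%:R * apex T = pi - apex T :> R.
Proof.
have := mul_apex (R := R) T.
rewrite (natrD _ 1 (2 * T)) natrM (natrD _ 1 T); lra.
Qed.

(** By the criterion for real quadratics, no
    sin s + a sin (M s) Z + b sin (N s) Z^2 with 0 < s < pi vanishes for
    |Z| < 1. *)
Definition univalence_conditions T a b := forall s, 0 < s < pi ->
  `|b * sin ((1 + 2 * T)%:R * s)| <= sin s /\
  `|a * sin ((1 + T)%:R * s)| <= sin s + b * sin ((1 + 2 * T)%:R * s).

(** The sign - |a| keeps the information of both signs of a. *)
Lemma univalence_conditions_ge0 T a b : univalence_conditions T a b ->
  forall s, 0 < s < pi -> 0 <= sin_trinomial T (- `|a|) b s.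
Proof.
move=> conds s s0pi; have [_] := conds s s0pi.
have : - `|a| * sin ((1 + T)%:R * s) >= - `|a * sin ((1 + T)%:R * s)|.
  by rewrite normrM mulNr lerN2 ler_wpM2l// ler_norm.
rewrite /sin_trinomial; lra.
Qed.

(** Divide the first condition by s and let s tend to 0. *)
Lemma norm_b_le T a b : univalence_conditions T a b -> `|b| <= b0 R T.
Proof.
move=> conds; have pi0 := @pi_gt0 R.
have N0 : 0 < (1 + 2 * T)%:R :> R by rewrite ltr0n.
suff sgnb e : e ^+ 2 = 1 -> 0 <= 1 + e * b * (1 + 2 * T)%:R.
  rewrite /b0 ler_pdivlMr// -[X in _ * X]ger0_norm ?ler0n// -normrM ler_norml.
  have := sgnb 1; have := sgnb (-1); rewrite sqrrN expr1n => /(_ erefl) h /(_ erefl).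
  by move: h; move=> h1 h2; apply/andP; split; lra.
move=> e1; have e0 : `|e| = 1.
  by apply/eqP; rewrite -(@pexpr_eq1 _ _ 2)// -normrX e1 normr1.
have := @derive_ge0_right R _ 0 pi _ (is_derive_sin_trinomial T 0 (e * b) 0) pi0.
rewrite !mulr0 cos0 !mulr1 mul0r addr0; apply => t t0pi.
rewrite /sin_trinomial !mulr0 !mul0r sin0 !addr0 !mulr0.
have [+ _] := conds t t0pi; rewrite -mulrA -[X in X <= _]mul1r -e0 -normrM ler_norml.
lra.
Qed.

(** At s = apex, sin ((1 + T) s) = 1 and sin ((1 + 2 T) s) = sin s. *)
Lemma norm_a_le T a b : univalence_conditions T a b -> `|a| <= (1 + b) * sin (apex T).
Proof.
move=> conds; have := univalence_conditions_ge0 _ _ _ conds (apex T).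
rewrite apex_gt0 apex_lt_pi => /(_ isT).
rewrite /sin_trinomial mul_apex natr_apex sin_pihalf sinB sinpi cospi; lra.
Qed.

(** The nonnegative function of [univalence_conditions_ge0] vanishes at the apex,
    so its derivative cos (apex) (1 - (1 + 2 T) b) vanishes there too. *)
Lemma norm_a_eq T a b : (1 <= T)%N -> univalence_conditions T a b ->
  `|a| = (1 + b) * sin (apex T) -> b = b0 R T.
Proof.
move=> T1 conds aE; have pi0 := @pi_gt0 R.
have d0 : is_derive (apex T) 1 (sin_trinomial T (- `|a|) b) 0.
  apply: (derive1_at_min (ltW pi0)) => [t _||t].
  - by apply: ex_derive; exact: is_derive_sin_trinomial.
  - by rewrite in_itv/= apex_gt0 apex_lt_pi.
  rewrite in_itv/= => /(univalence_conditions_ge0 _ _ _ conds); apply: le_trans.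
  by rewrite /sin_trinomial mul_apex natr_apex sin_pihalf sinB sinpi cospi aE; lra.
have := @derive_val _ _ _ _ _ _ _ d0.
rewrite (@derive_val _ _ _ _ _ _ _ (is_derive_sin_trinomial T _ _ _)).
rewrite mul_apex natr_apex cos_pihalf cosB sinpi cospi => h.
have cosa : cos (apex T) != 0 :> R.
  have ap := @apex_gt0 R T; have apl := @apex_le R T T1.
  by rewrite gt_eqF// cos_gt0_pihalf//; apply/andP; split; lra.
have N0 : (1 + 2 * T)%:R != 0 :> R by rewrite pnatr_eq0.
apply: (mulIf N0); rewrite [RHS]mulrC natr_b0; apply: (mulIf cosa); lra.
Qed.

Lemma norm_ab_le T a b : (1 <= T)%N -> univalence_conditions T a b ->
  `|a| + `|b| <= a0 R T + b0 R T.
Proof.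
move=> T1 conds; have := norm_b_le _ _ _ conds; have := norm_a_le _ _ _ conds.
have := sin_apex_lt1 _ T1; have := sin_apex_gt0 (R := R) T; have := b0_gt0 T; rewrite a0E.
move: (sin _) (b0 _ _) => k c; case: (ger0P b); nra.
Qed.

Lemma norm_ab_eq T a b : (1 <= T)%N -> univalence_conditions T a b ->
  `|a| + `|b| = a0 R T + b0 R T -> `|a| = a0 R T /\ b = b0 R T.
Proof.
move=> T1 conds abE; have bE : b = b0 R T.
  move: abE; have := norm_b_le _ _ _ conds; have := norm_a_le _ _ _ conds.
  have := sin_apex_lt1 _ T1; have := sin_apex_gt0 (R := R) T; have := b0_gt0 T; rewrite a0E.
  move: (sin _) (b0 _ _) => k c; case: (ger0P b); nra.
by split=> //; move: abE; rewrite bE (gtr0_norm (b0_gt0 T)); lra.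
Qed.

Lemma extremal_conditions T e : e ^+ 2 = 1 ->
  univalence_conditions T (e * a0 R T) (b0 R T).
Proof.
move=> e1 s /andP[s0 spi]; have s0pi : 0 <= s <= pi by rewrite !ltW.
split.
  rewrite normrM (gtr0_norm (b0_gt0 T)) mulrC /b0 div1r ler_pdivrMr ?ltr0n// [leRHS]mulrC.
  exact: norm_sin_mul_le.
have := sin_trinomial_extremal_ge0 T _ _ e1 s0pi.
have := sin_trinomial_extremal_ge0 T (- e) s _ s0pi; rewrite sqrrN => /(_ e1).
by rewrite /sin_trinomial ler_norml => h1 h2; apply/andP; split; lra.
Qed.

End CoefficientRegion.

(** * Univalence of trinomials *)

Section Univalence.
Context {R : realType}.
Implicit Types (a b e s t : R) (T : nat) (z w u : R[i]) (P : {poly R[i]}).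

Lemma derivable_horner_complex P z :
  derivable (horner P : (R[i])^o -> (R[i])^o) z 1.
Proof.
elim/poly_ind: P => [|p c ih].
  rewrite (_ : horner 0 = cst 0); first exact: derivable_cst.
  by apply/funext => w; rewrite horner0.
rewrite (_ : horner _ = (horner p : (R[i])^o -> (R[i])^o) * id + cst c).
  apply: derivableD; last exact: derivable_cst.
  by apply: derivableM; last exact: derivable_id.
by apply/funext => w; rewrite !hornerE.
Qed.

Lemma univalentP P : (forall z w, `|z| < 1 -> `|w| < 1 -> P.[z] = P.[w] -> z = w) <->
  univalent (horner P).
Proof.
split=> [inj|[_ inj] z w z1 w1]; last by apply: inj; rewrite inE.
by split=> [z _|z w]; [exact: derivable_horner_complex|rewrite !inE; exact: inj].
Qed.

(** A zero z of the quadratic in the disk is some u ^+ T with |u| < 1, so that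
    u e^(is) and u e^(-is) are distinct points with the same image. *)
Lemma univalent_conditions T a b : (1 <= T)%N ->
  univalent (horner (trinomial T a b)) -> univalence_conditions T a b.
Proof.
move=> T1 [_ inj] s s0pi; have sins := sin_gt0_pi s0pi.
apply: quadratic_disk_free_coef => // z z1; apply/negP => /eqP zE.
have zn0 : z != 0.
  apply/eqP => z0; move/eqP: zE; rewrite z0 expr0n /= !mulr0 !addr0.
  by rewrite eq_complex /= gt_eqF.
pose u := T.-root z.
have uT : u ^+ T = z by rewrite rootCK.
have un0 : u != 0 by apply: contra_neq zn0 => u0; rewrite -uT u0 expr0n gtn_eqF.
have u1 : `|u| < 1.
  by rewrite -(@expr_lt1 _ T) -?normrX ?uT//.
have := trinomial_sub_conj T a b u s; rewrite uT zE mulr0 => /eqP.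
rewrite subr_eq0 => /eqP/inj; rewrite !inE /unit_disk /= !normrM !norm_expi !mulr1.
move=> /(_ u1 u1)/(mulfI un0)/eqP; rewrite -subr_eq0 expi_subN.
rewrite !mulf_eq0 pnatr_eq0 eq_complex /= oner_eq0 andbF eq_complex /=.
by rewrite gt_eqF.
Qed.

Lemma upper_unit_expi (x y : R) : x ^+ 2 + y ^+ 2 = 1 -> 0 < y ->
  exists2 s, 0 < s < pi & expi s = x +i* y.
Proof.
move=> xy y0; have x1 : -1 < x < 1 by apply/andP; split; nra.
have x1' : -1 <= x <= 1 by case/andP: x1 => h1 h2; rewrite !ltW.
exists (acos x).
  by case/andP: x1 => h1 h2; rewrite acos_gt0 ?acos_ltpi ?h1 ?h2 ?ltW.
rewrite /expi acosK ?in_itv// sin_acos//; congr (_ +i* _).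
by rewrite -xy [x ^+ 2 + _]addrC addrK sqrtr_sqr gtr0_norm.
Qed.

(** Take u to be a square root of z w: then z / u has modulus 1 and w / u is its
    inverse.  The other square root is used when Im (z / u) < 0. *)
Lemma conjugate_form z w : `|z| = `|w| -> z != w ->
  exists u s, [/\ 0 < s < pi, `|u| = `|z| &
    (z = u * expi s /\ w = u * expi (- s))].
Proof.
move=> zw znw.
have z0 : z != 0.
  apply: contra_neq znw => z0; move: zw; rewrite z0 normr0 => /esym/eqP.
  by rewrite normr_eq0 => /eqP.
pose u := sqrtc (z * w); have uE : u ^+ 2 = z * w by rewrite sqr_sqrtc.
have uz : `|u| = `|z|.
  apply/eqP; rewrite -(@eqrXn2 _ 2)// -normrX uE normrM -zw.
  by rewrite expr2.
have u0 : u != 0 by rewrite -normr_eq0 uz normr_eq0.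
have : `|z / u| = 1 by rewrite normrM normfV uz divff// normr_eq0.
have zE : z = u * (z / u) by rewrite mulrC divfK.
have wE : w = u * (z / u)^-1.
  by rewrite invf_div mulrA -expr2 uE mulrAC divff// mul1r.
move: zE wE; case: (z / u) => x y zE wE.
rewrite [`|x +i* y|]normc_def /= => -[/(congr1 (fun t => t ^+ 2))].
rewrite expr1n sqr_sqrtr ?addr_ge0 ?sqr_ge0// => xy1.
have inv : (x +i* y)^-1 = x -i* y.
  by rewrite -[LHS]/((x / _) +i* (- (y / _))) xy1 !divr1.
have expiN s : expi s = x +i* y -> expi (- s) = x -i* y.
  by rewrite /expi cosN sinN => -[-> ->].
have expiN' s : expi s = (- x) +i* (- y) -> expi (- s) = (- x) +i* y.
  by rewrite /expi cosN sinN => -[-> ->]; rewrite opprK.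
case: (ltgtP y 0) => y0.
- have [||s s0pi sE] := upper_unit_expi (- x) (- y).
    by rewrite !sqrrN.
    by rewrite oppr_gt0.
  exists (- u), s; split; rewrite ?normrN//.
  rewrite sE expiN' // zE wE inv; split; rewrite mulNr -mulrN; congr (_ * _);
    by apply/eqP; rewrite eq_complex /= !opprK !eqxx.
- have [s s0pi sE] := upper_unit_expi x y xy1 y0.
  exists u, s; split; rewrite ?normrN//.
  by rewrite sE expiN // -inv.
- exfalso; move/eqP: znw; apply.
  by rewrite zE wE inv y0 oppr0.
Qed.

Lemma univalence_conditions_circle T a b : (1 <= T)%N ->
  univalence_conditions T a b ->
  forall z w, `|z| < 1 -> `|z| = `|w| ->
  (trinomial T a b).[z] = (trinomial T a b).[w] -> z = w.
Proof.
move=> T1 conds z w z1 zw Pzw; apply/eqP; rewrite -[_ == _]negbK; apply/negP => znw.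
have [u [s [s0pi uz [zE wE]]]] := conjugate_form _ _ zw znw.
have [hb ha] := conds s s0pi.
move/eqP: Pzw; rewrite -subr_eq0 zE wE trinomial_sub_conj; apply/negP.
have u0 : u != 0.
  by apply: contra_neq znw => u0; rewrite zE wE u0 !mul0r.
rewrite !mulf_neq0 ?pnatr_eq0//; first by rewrite eq_complex /= oner_eq0 andbF.
apply: quadratic_disk_free => //; first exact: sin_gt0_pi.
by rewrite normrX exprn_ilt1 ?uz// -lt0n.
Qed.

Lemma horner_deriv_trinomial T a b z : (trinomial T a b)^`().[z] =
  1 + ((1 + T)%:R * a)%:C * z ^+ T + ((1 + 2 * T)%:R * b)%:C * (z ^+ T) ^+ 2.
Proof.
rewrite /trinomial !derivD !derivZ derivX !derivXn.
rewrite !(hornerD, hornerZ, hornerMn, hornerXn) -polyC1 hornerC.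
rewrite (_ : (1 + T).-1 = T) // (_ : (1 + 2 * T).-1 = (T * 2)%N); last lia.
rewrite exprM !rmorphM !rmorph_nat.
by rewrite -[z ^+ T *+ _]mulr_natr -[_ ^+ 2 *+ _]mulr_natr; ring.
Qed.

Lemma sqr1_norm e : e ^+ 2 = 1 -> `|e| = 1.
Proof. by move=> e1; apply/eqP; rewrite -(@pexpr_eq1 _ _ 2)// -normrX e1 normr1. Qed.

(** With w = z ^+ T, the derivative of the extremal trinomial is
    1 + (1 + T) e a0 w + w^2; this is the bound that keeps it from vanishing in
    the disk. *)
Lemma norm_linear_coef_le T e : e ^+ 2 = 1 ->
  `|(1 + T)%:R * (e * a0 R T)| <= 1 + 1.
Proof.
move=> e1; rewrite mulrCA normrM (sqr1_norm _ e1) mul1r ger0_norm; last first.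
  by rewrite mulr_ge0 ?ler0n// ltW ?a0_gt0.
by apply: (le_trans (a0_natr_le T)); lra.
Qed.

Lemma univalent_extremal T e : (1 <= T)%N -> e ^+ 2 = 1 ->
  univalent (horner (trinomial T (e * a0 R T) (b0 R T))).
Proof.
move=> T1 e1; apply/univalentP; apply: Darboux_injective; last first.
  exact: univalence_conditions_circle T1 (extremal_conditions _ _ e1).
move=> z z1; rewrite horner_deriv_trinomial natr_b0.
apply: quadratic_disk_free; rewrite ?ltr01 ?normr1//.
- exact: norm_linear_coef_le.
- by rewrite normrX exprn_ilt1 // -lt0n.
Qed.

End Univalence.

(** * Trinomials as polynomials: coefficients, symmetries, values *)

Section TrinomialClass.
Context {R : realType}.
Implicit Types (a b e s t : R) (T : nat) (z w u : R[i]) (P Q : {poly R[i]}).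

Lemma norm_real (x : R) : `|x%:C| = `|x|%:C :> R[i].
Proof. by rewrite normc_def /= expr0n addr0 sqrtr_sqr. Qed.

Lemma coef_trinomial T a b j : (1 <= T)%N -> (trinomial T a b)`_j =
  if j == 1%N then 1 else if j == (1 + T)%N then a%:C
  else if j == (1 + 2 * T)%N then b%:C else 0.
Proof.
move=> T1; have e12 : (1 == 1 + T)%N = false by lia.
have e13 : (1 == 1 + 2 * T)%N = false by lia.
have e23 : (1 + T == 1 + 2 * T)%N = false by lia.
rewrite /trinomial !(coefD, coefZ, coefX, coefXn).
have [->|_] := eqVneq j 1%N; first by rewrite e12 e13 !mulr0 !addr0.
have [->|_] := eqVneq j (1 + T)%N.
  by rewrite e23 mulr0 mulr1 addr0 add0r.
by case: eqP => _; rewrite !(mulr0, mulr1, add0r).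
Qed.

Lemma size_trinomial T a b : (1 <= T)%N -> b != 0 ->
  size (trinomial T a b) = (1 + 2 * T).+1.
Proof.
move=> T1 bn0; have bC : b%:C != 0 by rewrite eq_complex /= (negPf bn0).
rewrite /trinomial addrC size_polyDl size_scale ?size_polyXn//.
rewrite (leq_ltn_trans (size_polyD _ _))// size_polyX gtn_max.
rewrite (leq_ltn_trans (size_scale_leq _ _)) ?size_polyXn; lia.
Qed.

Lemma lead_coef_trinomial T a b : (1 <= T)%N -> b != 0 ->
  lead_coef (trinomial T a b) = b%:C.
Proof.
move=> T1 bn0; rewrite lead_coefE size_trinomial// coef_trinomial//= eqxx.
by do 2![case: eqP => [|_]; first lia].
Qed.

Lemma size_trinomial_neq0 T a b : (1 <= T)%N ->
  size (trinomial T a b) = (1 + 2 * T).+1 -> b != 0.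
Proof.
move=> T1 sP; apply/eqP => b0.
have : lead_coef (trinomial T a b) = 0.
  rewrite lead_coefE sP coef_trinomial//= b0 eqxx.
  by do 2![case: eqP => [|_]; first lia].
by move/eqP; rewrite lead_coef_eq0 -size_poly_eq0 sP.
Qed.

Lemma S_classP T P : (1 <= T)%N -> S_class T P <->
  exists a b, [/\ P = trinomial T a b, b != 0 & univalent (horner P)].
Proof.
move=> T1; split=> [[[a [b PE]] sP uP]|[a [b [PE bn0 uP]]]].
  by exists a, b; split=> //; apply: (@size_trinomial_neq0 T a); rewrite -?PE.
by split=> //; [exists a, b|rewrite PE size_trinomial].
Qed.

Lemma norm_horner_trinomial_le T a b z : `|z| <= 1 ->
  `|(trinomial T a b).[z]| <= (1 + `|a| + `|b|)%:C.
Proof.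
move=> z1; have zn n : `|z ^+ n| <= 1 by rewrite normrX exprn_ile1.
rewrite horner_trinomial !rmorphD /= -!norm_real.
rewrite (le_trans (ler_normD _ _))// lerD//.
  rewrite (le_trans (ler_normD _ _))// lerD// normrM ler_piMr//.
by rewrite normrM ler_piMr.
Qed.

(** exp (i pi / T) is a T-th root of -1. *)
Lemma expi_pi_divX T n : (1 <= T)%N ->
  expi (pi / T%:R) ^+ (1 + n * T) = (-1) ^+ n * expi (pi / T%:R) :> R[i].
Proof.
move=> T1; have T0 : T%:R != 0 :> R by rewrite pnatr_eq0 -lt0n.
rewrite exprD expr1 mulrC; congr (_ * _); rewrite mulnC exprM; congr (_ ^+ n).
by rewrite expiX mulrCA divff// mulr1 expi_pi.
Qed.

Lemma expi_pi_divX1 T : (1 <= T)%N ->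
  expi (pi / T%:R) ^+ (1 + T) = - expi (pi / T%:R) :> R[i].
Proof. by move=> T1; have := expi_pi_divX T 1 T1; rewrite mul1n expr1 mulN1r. Qed.

Lemma expi_pi_divX2 T : (1 <= T)%N ->
  expi (pi / T%:R) ^+ (1 + 2 * T) = expi (pi / T%:R) :> R[i].
Proof. by move=> T1; rewrite expi_pi_divX// sqrrN expr1n mul1r. Qed.

Lemma horner_trinomial_expi T a b : (1 <= T)%N ->
  `|(trinomial T a b).[expi (pi / T%:R)]| = `|1 - a + b|%:C.
Proof.
move=> T1; rewrite horner_trinomial.
rewrite expi_pi_divX1// expi_pi_divX2//.
rewrite (_ : _ + _ = (1 - a + b)%:C * expi (pi / T%:R)).
  by rewrite normrM norm_expi mulr1 norm_real.
by rewrite rmorphD rmorphB rmorph1 /=; ring.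
Qed.

Lemma rotation_trinomial T a b : (1 <= T)%N ->
  rotation (pi / T%:R) (trinomial T a b) = trinomial T (- a) b.
Proof.
move=> T1; rewrite /rotation /trinomial !comp_polyD !comp_polyZ comp_polyX !comp_Xn_poly.
rewrite !exprZn expi_pi_divX1// expi_pi_divX2// !scalerDr !scalerA.
have inv : expi (- (pi / T%:R)) * expi (pi / T%:R) = 1 :> R[i].
  by rewrite -expiD addNr expi0.
rewrite inv scale1r rmorphN /=; congr (_ + _ *: _ + _ *: _); last first.
  by rewrite mulrAC inv mul1r.
by rewrite mulrN mulrAC inv mul1r.
Qed.

Lemma neg_reflection_trinomial T a b :
  neg_reflection (trinomial T a b) = trinomial T ((-1) ^+ T * a) b.
Proof.
rewrite /neg_reflection /trinomial !comp_polyD !comp_polyZ comp_polyX !comp_Xn_poly.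
rewrite !opprD opprK -[- 'X]scaleN1r !exprZn !scalerA -!scaleNr.
congr (_ + _ *: _ + _ *: _).
  by rewrite exprD rmorphM rmorphXn rmorphN1 /=; rewrite /GRing.scale /=; ring.
by rewrite exprD expr1 exprM sqrrN !expr1n /GRing.scale /=; ring.
Qed.

End TrinomialClass.

(** * The extremal problems *)

Section Extremality.
Context {R : realType} (T : nat) (T1 : (1 <= T)%N).
Implicit Types (a b e s t : R) (z w u : R[i]) (P Q : {poly R[i]}).

(** The sign e covers S, its rotation by pi / T and its reflection at once. *)
Definition extremal_trinomial e : {poly R[i]} := trinomial T (e * a0 R T) (b0 R T).

Lemma S_polyE : S_poly R T = extremal_trinomial 1.
Proof. by rewrite /extremal_trinomial mul1r. Qed.

Lemma rotation_S_polyE : rotation (pi / T%:R) (S_poly R T) = extremal_trinomial (-1).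
Proof. by rewrite rotation_trinomial// /extremal_trinomial mulN1r. Qed.

Lemma neg_reflection_S_polyE : neg_reflection (S_poly R T) = extremal_trinomial ((-1) ^+ T).
Proof. exact: neg_reflection_trinomial. Qed.

Lemma b0_neq0 : b0 R T != 0. Proof. by rewrite gt_eqF ?b0_gt0. Qed.

Lemma S_class_extremal e : e ^+ 2 = 1 -> S_class T (extremal_trinomial e).
Proof.
move=> e1; apply/S_classP => //; exists (e * a0 R T), (b0 R T).
by split; [|exact: b0_neq0|exact: univalent_extremal].
Qed.

Lemma S_class_conditions P : S_class T P ->
  exists a b, [/\ P = trinomial T a b, b != 0 & univalence_conditions T a b].
Proof.
move=> /S_classP => /(_ T1)[a [b [PE bn0 uP]]]; exists a, b; split=> //.
by apply: univalent_conditions => //; rewrite -PE.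
Qed.

(** In w = z ^+ T the derivative is 1 + k w + w^2, so w and 1 / w are zeros
    together, while none lies in the disk. *)
Lemma extremal_quasi_extremal e : e ^+ 2 = 1 -> quasi_extremal (extremal_trinomial e).
Proof.
move=> e1.
have nz w : `|w| < 1 -> 1 + ((1 + T)%:R * (e * a0 R T))%:C * w + w ^+ 2 != 0.
  move=> w1; have := quadratic_disk_free 1 ((1 + T)%:R * (e * a0 R T)) 1 w ltr01.
  rewrite rmorph1 mul1r; apply=> //; first by rewrite normr1.
  exact: norm_linear_coef_le.
move=> z; rewrite /root horner_deriv_trinomial natr_b0 rmorph1 mul1r => rz.
have zn0 : z != 0.
  apply: contraL rz => /eqP->; rewrite expr0n gtn_eqF//= mulr0 expr0n /= !addr0.
  exact: oner_neq0.
have zT0 : z ^+ T != 0 by rewrite expf_neq0.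
have zT1 : `|z ^+ T| = 1.
  apply/le_anti/andP; split; rewrite real_leNgt ?normr_real ?real1//.
    apply: contraL rz => zT1.
    have : `|(z ^+ T)^-1| < 1 by rewrite normfV invf_lt1// normr_gt0.
    move=> /nz; apply: contra => /eqP h; apply/eqP; apply: (mulIf (expf_neq0 2 zT0)).
    by rewrite mul0r -[RHS]h; field.
  by apply: contraL rz => /nz.
by apply/eqP; rewrite -(@pexpr_eq1 _ _ T)// -normrX zT1.
Qed.

Lemma S_class_lead_trinomial P : S_class_lead T P ->
  exists a, P = trinomial T a (b0 R T) /\ univalence_conditions T a (b0 R T).
Proof.
move=> [/S_class_conditions[a [b [PE bn0 conds]]]].
rewrite PE lead_coef_trinomial// -(rmorph_nat (real_complex R)) -fmorphV => -[bE].
by exists a; move: conds; rewrite bE /b0 div1r.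
Qed.

Lemma coef_extremal_extremal e : e ^+ 2 = 1 -> coef_extremal T (extremal_trinomial e).
Proof.
move=> e1; split; first split; first exact: S_class_extremal.
  by rewrite lead_coef_trinomial ?b0_neq0// /b0 div1r fmorphV rmorph_nat.
move=> Q /S_class_lead_trinomial[a [-> conds]] j; rewrite !coef_trinomial//.
case: eqP => // _; case: eqP => // _; rewrite !norm_real lecR.
rewrite normrM (sqr1_norm _ e1) mul1r (gtr0_norm (a0_gt0 T)) a0E; exact: norm_a_le.
Qed.

Lemma coef_extremal_unique P : coef_extremal T P ->
  P = extremal_trinomial 1 \/ P = extremal_trinomial (-1).
Proof.
move=> [Plead Pmax]; have [a [PE conds]] := S_class_lead_trinomial _ Plead.
have [ext1 _] := coef_extremal_extremal 1 (expr1n _ _).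
have := Pmax _ ext1 (1 + T)%N.
rewrite PE !coef_trinomial// eqxx ifN; last lia.
rewrite ifN; last lia.
rewrite !norm_real lecR mul1r (gtr0_norm (a0_gt0 T)) => a0a.
have : `|a| = a0 R T.
  by apply/le_anti; rewrite a0a andbT a0E norm_a_le.
rewrite /extremal_trinomial mul1r mulN1r.
by case: (ger0P a) => _ aE; [left|right]; rewrite -aE ?opprK.
Qed.

Definition maximum_value : R := 1 + a0 R T + b0 R T.

Lemma S_poly_1 : (S_poly R T).[1] = maximum_value%:C.
Proof. by rewrite horner_trinomial !expr1n !mulr1 !rmorphD rmorph1. Qed.

(** All three terms of the trinomial are aligned at z = 1 when e = 1, and at
    z = exp (i pi / T) when e = -1. *)
Lemma extremal_attained e : e ^+ 2 = 1 ->
  exists2 z, `|z| <= 1 & `|(extremal_trinomial e).[z]| = maximum_value%:C.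
Proof.
have m0 : 0 < maximum_value by rewrite !addr_gt0 ?a0_gt0 ?b0_gt0.
move/eqP; rewrite sqrf_eq1 => /orP[]/eqP->.
  by exists 1; rewrite ?normr1// -S_polyE S_poly_1 norm_real gtr0_norm.
exists (expi (pi / T%:R)); rewrite ?norm_expi// horner_trinomial_expi//.
rewrite mulN1r opprK gtr0_norm //.
Qed.

Lemma max_modulus_extremal e : e ^+ 2 = 1 ->
  max_modulus (extremal_trinomial e) maximum_value%:C.
Proof.
move=> e1; have [z z1 zE] := extremal_attained _ e1; split; first by exists z.
move=> _ [w w1 <-]; apply: le_trans (norm_horner_trinomial_le _ _ _ _ w1) _.
rewrite lecR normrM (sqr1_norm _ e1) mul1r (gtr0_norm (a0_gt0 T)).
by rewrite (gtr0_norm (b0_gt0 T)).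
Qed.

Lemma is_max_unique (A : set R[i]) m m' : is_max A m -> is_max A m' -> m = m'.
Proof.
move=> [Am mA] [Am' m'A]; apply/le_anti/andP; split; [exact: m'A|exact: mA].
Qed.

Lemma max_modulus_le P M : S_class T P -> max_modulus P M -> M <= maximum_value%:C.
Proof.
move=> /S_class_conditions[a [b [-> _ conds]]] [[z z1 <-] _].
apply: le_trans (norm_horner_trinomial_le _ _ _ _ z1) _.
by rewrite lecR /maximum_value -!addrA lerD2l; exact: norm_ab_le.
Qed.

Lemma is_max_max_moduli : is_max (@max_moduli R T) maximum_value%:C.
Proof.
split; last by move=> M [P SP PM]; exact: max_modulus_le PM.
have e1 : 1 ^+ 2 = 1 :> R by rewrite expr1n.
exists (extremal_trinomial 1); [exact: S_class_extremal|exact: max_modulus_extremal].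
Qed.

Lemma modulus_extremal_extremal e : e ^+ 2 = 1 ->
  modulus_extremal T (extremal_trinomial e).
Proof.
move=> e1; split; first exact: S_class_extremal.
by exists maximum_value%:C; [exact: max_modulus_extremal|exact: is_max_max_moduli].
Qed.

Lemma modulus_extremal_unique P : modulus_extremal T P ->
  P = extremal_trinomial 1 \/ P = extremal_trinomial (-1).
Proof.
move=> [/S_class_conditions[a [b [-> _ conds]]] [M [[z z1 zM] _]]].
move=> /(is_max_unique _ _ _ is_max_max_moduli) ME.
have : maximum_value%:C <= (1 + `|a| + `|b|)%:C.
  by rewrite ME -zM; exact: norm_horner_trinomial_le.
rewrite lecR /maximum_value -!addrA lerD2l => le_ab.
have [aE ->] : `|a| = a0 R T /\ b = b0 R T.
  apply: norm_ab_eq => //; apply/le_anti; rewrite le_ab andbT; exact: norm_ab_le.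
rewrite /extremal_trinomial mul1r mulN1r -aE.
by case: (ger0P a) => _; [left|right]; rewrite ?opprK.
Qed.

(** |a| < 1 + b, so both values 1 + b + a and 1 + b - a are positive. *)
Lemma distortion_trinomial a b : univalence_conditions T a b ->
  distortion T (trinomial T a b) = ((1 + b - a) / (1 + b + a))%:C /\ 0 < 1 + b + a.
Proof.
move=> conds; have := norm_a_le _ _ _ conds; have := norm_b_le _ _ _ conds.
have := @b0_lt1 R _ T1; have := @sin_apex_lt1 R _ T1; have := @sin_apex_gt0 R T.
rewrite !ler_norml; move: (sin _) (b0 _ _) => k c k0 k1 c1 /andP[b1 b2] /andP[a1 a2].
have pos : 0 < 1 + b + a by nra.
have pos' : 0 < 1 - a + b by nra.
split=> //; rewrite /distortion horner_trinomial_expi// (gtr0_norm pos').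
rewrite horner_trinomial !expr1n !mulr1 mulrC div1r.
rewrite (_ : 1 + _ + _ = (1 + b + a)%:C); last by rewrite !rmorphD rmorph1 /=; ring.
by rewrite -fmorphV -rmorphM /= addrAC.
Qed.

(** The quotient (1 + b - a) / (1 + b + a) decreases with a / (1 + b), which is at
    most sin (apex), with equality for S. *)
Lemma distortion_le a b : univalence_conditions T a b ->
  distortion T (S_poly R T) <= distortion T (trinomial T a b).
Proof.
move=> conds; have [-> p1] := distortion_trinomial _ _ conds.
have [] := distortion_trinomial _ _ (extremal_conditions T 1 (expr1n _ _)).
rewrite mul1r => -> p2; rewrite lecR ler_pdivlMr// mulrAC ler_pdivrMr//.
have : a <= (1 + b) * sin (apex T) := le_trans (ler_norm a) (norm_a_le _ _ _ conds).
have := b0_gt0 (R := R) T; rewrite a0E.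
move: (sin _) (b0 _ _) => k c; nra.
Qed.

Lemma distortion_eq a b : univalence_conditions T a b ->
  distortion T (trinomial T a b) <= distortion T (S_poly R T) ->
  trinomial T a b = S_poly R T.
Proof.
move=> conds; have [-> p1] := distortion_trinomial _ _ conds.
have [] := distortion_trinomial _ _ (extremal_conditions T 1 (expr1n _ _)).
rewrite mul1r => -> p2; rewrite lecR ler_pdivlMr// mulrAC ler_pdivrMr// => le.
have le_a := norm_a_le _ _ _ conds.
have ge_a : (1 + b) * sin (apex T) <= a.
  move: le; have := b0_gt0 (R := R) T; rewrite a0E.
  move: (sin _) (b0 _ _) => k c; nra.
have aE : a = (1 + b) * sin (apex T).
  by apply/le_anti; rewrite ge_a (le_trans (ler_norm a)).
have bE : b = b0 R T.
  apply: (norm_a_eq T a) => //; apply/le_anti; rewrite le_a.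
  by rewrite (le_trans ge_a)// ler_norm.
by rewrite /S_poly aE bE -a0E.
Qed.

Lemma is_min_distortions : is_min (@distortions R T) (distortion T (S_poly R T)).
Proof.
split.
  by exists (S_poly R T) => //; rewrite S_polyE; apply: S_class_extremal; rewrite expr1n.
by move=> _ [P /S_class_conditions[a [b [-> _ conds]]] <-]; exact: distortion_le.
Qed.

Lemma distortion_extremal_unique P : distortion_extremal T P <-> P = S_poly R T.
Proof.
split=> [[/S_class_conditions[a [b [-> _ conds]]] [_ Pmin]]|->].
  apply: distortion_eq => //; apply: Pmin; exact: is_min_distortions.1.
split; last exact: is_min_distortions.
by rewrite S_polyE; apply: S_class_extremal; rewrite expr1n.
Qed.

End Extremality.

Theorem mainTheorem2 (R : realType) (T : nat) (hT : (1 <= T)%N) :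
  let S : {poly R[i]} := S_poly R T in
  [/\ univalent (horner S),
      quasi_extremal S,
      [/\ coef_extremal T S,
          coef_extremal T (neg_reflection S),
          odd T -> forall P : {poly R[i]},
            coef_extremal T P <-> P = S \/ P = neg_reflection S &
          forall P : {poly R[i]},
            coef_extremal T P <-> P = S \/ P = rotation (pi / T%:R) S],
      [/\ is_max (@max_moduli R T) S.[1],
          modulus_extremal T S,
          modulus_extremal T (neg_reflection S),
          odd T -> forall P : {poly R[i]},
            modulus_extremal T P <-> P = S \/ P = neg_reflection S &
          forall P : {poly R[i]},
            modulus_extremal T P <-> P = S \/ P = rotation (pi / T%:R) S] &
      is_min (@distortions R T) (1 / S.[1] * `|S.[expi (pi / T%:R)]|) /\
      forall P : {poly R[i]}, distortion_extremal T P <-> P = S].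
Proof.
move=> S.
have e1 : 1 ^+ 2 = 1 :> R by rewrite expr1n.
have eN1 : (-1) ^+ 2 = 1 :> R by rewrite sqrrN expr1n.
have eT : ((-1) ^+ T) ^+ 2 = 1 :> R by rewrite exprAC eN1 expr1n.
have coefP P : coef_extremal T P <-> P = S \/ P = rotation (pi / T%:R) S.
  rewrite /S rotation_S_polyE// S_polyE.
  split=> [|[]->]; [exact: coef_extremal_unique|exact: coef_extremal_extremal..].
have modP P : modulus_extremal T P <-> P = S \/ P = rotation (pi / T%:R) S.
  rewrite /S rotation_S_polyE// S_polyE.
  split=> [|[]->]; [exact: modulus_extremal_unique|exact: modulus_extremal_extremal..].
have odd_rotation : odd T -> neg_reflection S = rotation (pi / T%:R) S.
  by move=> oT; rewrite neg_reflection_S_polyE rotation_S_polyE// -signr_odd oT expr1.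
split; [by rewrite /S S_polyE; exact: univalent_extremal|
        by rewrite /S S_polyE; exact: extremal_quasi_extremal|split|split|].
- by apply/coefP; left.
- by rewrite neg_reflection_S_polyE; exact: coef_extremal_extremal.
- by move=> /odd_rotation->.
- exact: coefP.
- by rewrite S_poly_1; exact: is_max_max_moduli.
- by apply/modP; left.
- by rewrite neg_reflection_S_polyE; exact: modulus_extremal_extremal.
- by move=> /odd_rotation->.
- exact: modP.
- by split=> [|P]; [exact: is_min_distortions|exact: distortion_extremal_unique].
Qed.
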